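(* Let $\mathcal{U}$ be an ultrafilter over $\omega$. The forcing notion $\mathbb{L}_{\mathcal{U}}$ has the Laver property if and only if $\mathcal{U}$ is a Laver ultrafilter.
   Context: By an ultrafilter we always mean a non-principal ultrafilter. Laver ultrafilter: an ultrafilter $\mathcal{U}$ over $\omega$ is a Laver ultrafilter if for every sequence $\langle \mathcal{P}_n : n\in\omega\rangle$, where each $\mathcal{P}_n$ is a partition of $\omega$ into finitely many sets, there exists $x\in\mathcal{U}$ such that for all $n\in\omega$, $x$ has non-empty intersection with at most $n+1$ elements of $\mathcal{P}_n$. Trees: a tree is a nonempty set $T$ of finite sequences closed under initial segments. Two elements of $T$ are compatible if one extends the other; $\operatorname{stem}(T)$ is the longest element of $T$ that is compatible with every member of $T$. Laver forcing relative to $\mathcal{U}$: $\mathbb{L}_{\mathcal{U}}$ is the set of all trees $T\subseteq\omega^{<\omega}$ such that for each $s\in T$ with $s\supseteq\operatorname{stem}(T)$, $\operatorname{succ}_T(s):=\{n\in\omega : s\cup\{\langle |s|,n\rangle\}\in T\}\in\mathcal{U}$, where $s\cup\{\langle |s|,n\rangle\}$ is the finite sequence obtained by appending $n$ to the end of $s$; a condition $T'$ is stronger than $T$ ($T'\le T$) iff $T'\subseteq T$. Laver property: a forcing notion $\mathbb{P}$ has the Laver property if the following holds: whenever $\dot f$ is a $\mathbb{P}$-name for an element of $\omega^\omega$ such that there is (in the ground model) $g\in\omega^\omega$ with $\Vdash_{\mathbb{P}}\dot f<g$ (pointwise), then $\mathbb{P}$ forces that there exists some $S\in\prod_{n\in\omega}[g(n)]^{\le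 n+1}$ in the ground model with $\dot f(n)\in S(n)$ for each $n\in\omega$. Here $[g(n)]^{\le n+1}$ is the set of subsets of $g(n)=\{0,\dots,g(n)-1\}$ of size at most $n+1$. *)

(* Defs.v *)
From mathcomp Require Import all_boot.
From mathcomp Require Import boolp classical_sets functions cardinality filter.

Set Implicit Arguments.
Unset Strict Implicit.
Unset Printing Implicit Defensive.

Local Open Scope classical_set_scope.
Local Open Scope card_scope.

(* [U] is an ultrafilter in the library's sense, which admits principal ones *)
Definition nonprincipal (U : set_system nat) : Prop := forall n, ~ U [set n].

Definition laver_ultrafilter (U : set_system nat) : Prop :=
  forall P : nat -> set (set nat),
    (forall n, finite_set (P n) /\ partition (P n) id [set: nat]) ->
    exists2 x : set nat, U x &
      forall n, [set A | P n A /\ x `&` A !=set0] #<= `I_n.+1.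

Record forcing_notion : Type := ForcingNotion {
  cond :> Type;
  stronger : cond -> cond -> Prop; (* [stronger q p] is q <= p *)
  top : cond;
  stronger_refl : forall p, stronger p p;
  stronger_trans : forall p q r,
    stronger r q -> stronger q p -> stronger r p;
  stronger_top : forall p, stronger p top }.

Arguments top {f}.
Arguments stronger {f}.

Declare Scope forcing_scope.
Delimit Scope forcing_scope with F.
Local Open Scope forcing_scope.
Notation "q ≼ p" := (stronger q p) (at level 70) : forcing_scope.

(* The ground model, as the well-founded sets over a universe. *)
Inductive gset : Type := GSet (I : Type) (elt : I -> gset).

Definition gset0 : gset := GSet (fun x : False => match x with end).

(* x ∪ {y} *)
Definition gadjoin (x y : gset) : gset :=
  let: GSet X e := x in
  GSet (fun o : option X => if o is Some i then e i else y).

Definition gupair (x y : gset) : gset :=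
  GSet (fun b : bool => if b then x else y).

Definition gpair (x y : gset) : gset := gupair (gupair x x) (gupair x y).

Fixpoint gnat (n : nat) : gset :=
  if n is k.+1 then gadjoin (gnat k) (gnat k) else gset0.

Definition gomega : gset := GSet gnat.

Definition gsubset (A : set nat) : gset := GSet (fun n : {n | A n} => gnat (sval n)).

Definition gfun (h : nat -> gset) : gset := GSet (fun n => gpair (gnat n) (h n)).

Section Forcing.
Variable P : forcing_notion.

(* [Name x c] is the P-name {(x i, c i) : i ∈ I} *)
Inductive name : Type := Name (I : Type) (x : I -> name) (c : I -> P).

Fixpoint check (x : gset) : name :=
  let: GSet X e := x in Name (fun i => check (e i)) (fun=> top).

Definition nupair (a b : name) : name :=
  Name (fun u : bool => if u then a else b) (fun=> top).

Definition npair (a b : name) : name := nupair (nupair a a) (nupair a b).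

(* A formula of the forcing language, identified with the set of conditions
   forcing it. *)
Definition formula : Type := P -> Prop.

Definition forces (p : P) (phi : formula) : Prop := phi p.

Definition dense_below (p : P) (D : P -> Prop) : Prop :=
  forall q, q ≼ p -> exists2 r, r ≼ q & D r.

(* p forces a = b iff every element of a, under the condition attached to it,
   is forced to be an element of b, and conversely. *)
Fixpoint feq (a b : name) : formula := fun p =>
  match a, b with
  | Name X x c, Name Y y d =>
      (forall i q, q ≼ p -> q ≼ c i ->
         dense_below q (fun r => exists2 j, r ≼ d j & feq (x i) (y j) r)) /\
      (forall j q, q ≼ p -> q ≼ d j ->
         dense_below q (fun r => exists2 i, r ≼ c i & feq (x i) (y j) r))
  end.

Definition fmem (a b : name) : formula := fun p =>
  let: Name Y y d := b in
  dense_below p (fun r => exists2 j, r ≼ d j & feq a (y j) r).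

Definition fand (phi psi : formula) : formula := fun p =>
  forces p phi /\ forces p psi.

(* Every formula built below holds at p as soon as it holds densely below p, so
   this clause says that no q <= p forces both phi and the negation of psi. *)
Definition fimp (phi psi : formula) : formula := fun p =>
  forall q, q ≼ p -> forces q phi -> forces q psi.

(* Quantification over all names, or (for [A] a type of ground-model objects)
   over elements of the extension that lie in the ground model. *)
Definition fforall (A : Type) (phi : A -> formula) : formula := fun p =>
  forall a, forces p (phi a).

Definition fexists (A : Type) (phi : A -> formula) : formula := fun p =>
  dense_below p (fun q => exists a, forces q (phi a)).

Definition fforall_in (a : name) (phi : name -> formula) : formula :=
  fforall (fun x : name => fimp (fmem x a) (phi x)).

Definition fexists_in (a : name) (phi : name -> formula) : formula :=
  fexists (fun x : name => fand (fmem x a) (phi x)).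

Definition nomega : name := check gomega.

Definition in_omega_omega (f : name) : formula :=
  fand
    (fforall_in f (fun z =>
       fexists_in nomega (fun n => fexists_in nomega (fun m =>
         feq z (npair n m)))))
    (fforall_in nomega (fun n => fexists_in nomega (fun m =>
       fand (fmem (npair n m) f)
            (fforall (fun k : name => fimp (fmem (npair n k) f) (feq k m)))))).

(* f(n) ∈ h(n) for all n ∈ ω; if h has values in ω this says f < h, the order
   of ω being membership. *)
Definition pointwise_in (f h : name) : formula :=
  fforall_in nomega (fun n =>
    fexists (fun m : name => fexists (fun s : name =>
      fand (fmem (npair n m) f) (fand (fmem (npair n s) h) (fmem m s))))).

End Forcing.

(* ∏_n [g(n)]^{≤ n+1}, as ground-model objects *)
Definition slalom (g : nat -> nat) : Type :=
  {S : nat -> set nat | forall n, S n `<=` `I_(g n) /\ S n #<= `I_n.+1}.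

Definition check_fun (P : forcing_notion) (g : nat -> nat) : name P :=
  check P (gfun (fun n => gnat (g n))).

Definition check_slalom (P : forcing_notion) (g : nat -> nat) (S : slalom g) :
    name P :=
  check P (gfun (fun n => gsubset (sval S n))).

Definition laver_property (P : forcing_notion) : Prop :=
  forall (f : name P) (g : nat -> nat),
    forces top (in_omega_omega f) ->
    forces top (pointwise_in f (check_fun P g)) ->
    forces top
      (fexists (fun S : slalom g => pointwise_in f (check_slalom P S))).

Definition tree (T : set (seq nat)) : Prop :=
  T !=set0 /\ forall s t, prefix s t -> T t -> T s.

Definition compatible (s t : seq nat) : bool := prefix s t || prefix t s.

Definition is_stem (T : set (seq nat)) (s : seq nat) : Prop :=
  let C := [set u | T u /\ forall t, T t -> compatible u t] in
  C s /\ forall u, C u -> size u <= size s.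

Definition succ_in (T : set (seq nat)) (s : seq nat) : set nat :=
  [set n | T (rcons s n)].

Definition laver_tree (U : set_system nat) (T : set (seq nat)) : Prop :=
  tree T /\
  exists2 s, is_stem T s & forall t, T t -> prefix s t -> U (succ_in T t).

Lemma laver_tree_setT (U : set_system nat) :
  UltraFilter U -> laver_tree U [set: seq nat].
Proof.
move=> UU; split; first by split => //; exists [::].
exists [::] => [|t _ _].
  split; first by split => // t _; rewrite /compatible prefix0s.
  move=> [//|a u] [_ /(_ [:: a.+1] I)].
  by rewrite /compatible /= ltn_eqF // gtn_eqF.
by apply: filterS filterT.
Qed.

Section LaverForcing.
Variables (U : set_system nat) (UU : UltraFilter U).

Definition laver_cond : Type := {T : set (seq nat) | laver_tree U T}.

Definition laver_le (T' T : laver_cond) : Prop := sval T' `<=` sval T.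

Lemma laver_le_refl T : laver_le T T.
Proof. exact: subset_refl. Qed.

Lemma laver_le_trans T T' T'' :
  laver_le T'' T' -> laver_le T' T -> laver_le T'' T.
Proof. exact: subset_trans. Qed.

Definition laver_top : laver_cond := exist _ setT (laver_tree_setT UU).

Lemma laver_le_top T : laver_le T laver_top.
Proof. by []. Qed.

Definition laver_forcing : forcing_notion :=
  ForcingNotion laver_le_refl laver_le_trans laver_le_top.

End LaverForcing.

(* Main.v *)
Require Import Defs.
From mathcomp Require Import all_boot.
From mathcomp Require Import boolp classical_sets functions cardinality filter.

(** Both properties bound the number of values of a bounded function: a Laver
    ultrafilter does it for functions on the natural numbers, restricted to a
    large set ([laver_ultrafilterP] replaces partitions by functions), and the
    Laver property does it for a name f of a function, below a condition.

    From the property to the ultrafilter, let l be the generic real, and let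
    f(n) code the n-th partition applied to l(0), ..., l(n-1).  Suppose that a
    condition with stem s forces f into a slalom.  Every element of the
    successor set x of s is a possible value of l(|s|), so for n > |s| the
    at most n+1 codes allowed for f(n) bound the number of pieces that x meets.
    For the finitely many n <= |s|, shrink x into a single piece of each partition.

    From the ultrafilter to the property, any two conditions with the same stem
    are compatible, so the conditions with stem s decide at most one value
    v(s, n) for f(n); they do decide one by [pure_decision].  Then v(s, n) is the
    limit along U of v(s^m, n) over the successors m of s.  For each node s,
    the ultrafilter being Laver gives a large set of successors among which
    v(s^m, n) takes at most n / 2^(j+1) values other than v(s, n), where j is the
    number of s in an enumeration of all finite sequences
    ([laver_slow_values]).  Pruning to these successors leaves, over the whole
    tree, at most 1 + n/2 + n/4 + ... <= n + 1 values v(s, n).  These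
    values are a slalom: if a condition below the pruned tree decides f(n), the
    decided value is v(t, n) for its stem t, and t is a node of the pruned tree.

    Both directions use the forced formulas through [pointwise_in_gfun], which
    reduces them to the density of conditions that force the check name of some
    pair (n, i) into f. *)

Set Implicit Arguments.
Unset Strict Implicit.
Unset Printing Implicit Defensive.

Local Open Scope classical_set_scope.
Local Open Scope card_scope.
Local Open Scope forcing_scope.

Lemma choice_exists2 X Y (P Q : X -> Y -> Prop) :
  (forall x, exists2 y, P x y & Q x y) ->
  exists2 f, (forall x, P x (f x)) & forall x, Q x (f x).
Proof.
move=> PQ; have /choice[f fP] x : exists y, P x y /\ Q x y.
  by have [y] := PQ x; exists y.
by exists f => x; have [] := fP x.
Qed.

(** * Names and the forcing relation *)

Section ForcingTheory.
Variable P : forcing_notion.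
Implicit Types (p q r : P) (a b c : name P) (f : name P).

Lemma dense_below_le (D : P -> Prop) p q :
  q ≼ p -> dense_below p D -> dense_below q D.
Proof. by move=> qp Dp r rq; apply: Dp; apply: stronger_trans rq qp. Qed.

Lemma dense_below_dense (D : P -> Prop) p :
  dense_below p (fun q => dense_below q D) -> dense_below p D.
Proof.
move=> Dp q /Dp[r rq /(_ r (stronger_refl r))[s sr Ds]].
by exists s => //; apply: stronger_trans sr rq.
Qed.

Lemma dense_below_mono (D E : P -> Prop) p :
  dense_below p D -> (forall r, r ≼ p -> D r -> E r) -> dense_below p E.
Proof.
move=> Dp DE q qp; have [r rq Dr] := Dp q qp; exists r => //.
by apply: DE Dr; apply: stronger_trans rq qp.
Qed.

Lemma dense_below_bind (D E : P -> Prop) p :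
  dense_below p D -> (forall r, r ≼ p -> D r -> dense_below r E) ->
  dense_below p E.
Proof. by move=> Dp DE; apply: dense_below_dense; apply: dense_below_mono DE. Qed.

Lemma dense_below_now (D : P -> Prop) p :
  (forall q, q ≼ p -> D q) -> dense_below p D.
Proof. by move=> Dp q qp; exists q; [exact: stronger_refl | exact: Dp]. Qed.

Lemma dense_below_ex (D : P -> Prop) p :
  dense_below p D -> exists2 q, q ≼ p & D q.
Proof. by apply; exact: stronger_refl. Qed.

Lemma feq_le a b p q : q ≼ p -> feq a b p -> feq a b q.
Proof.
case: a b => [X x c] [Y y d] qp [ab ba].
by split=> i r rq; [apply: ab|apply: ba]; apply: stronger_trans rq qp.
Qed.

Lemma feq_dense a b p : dense_below p (feq a b) -> feq a b p.
Proof.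
case: a b => [X x c] [Y y d] Dab.
split=> i q qp qi; apply: (dense_below_bind (dense_below_le qp Dab)).
  by move=> r rq [+ _]; apply; [exact: stronger_refl | exact: stronger_trans rq qi].
by move=> r rq [_ +]; apply; [exact: stronger_refl | exact: stronger_trans rq qi].
Qed.

Lemma feq_refl a p : feq a a p.
Proof.
elim: a p => X x IH c p; split=> i q qp qi; apply: dense_below_now => r rq;
  by exists i; [exact: stronger_trans rq qi | exact: IH].
Qed.

Lemma feq_sym a b p : feq a b p -> feq b a p.
Proof.
elim: a b p => X x IH c [Y y d] p [ab ba]; split=> i q qp qi.
  by apply: dense_below_mono (ba i q qp qi) _ => r _ [j rj /IH]; exists j.
by apply: dense_below_mono (ab i q qp qi) _ => r _ [j rj /IH]; exists j.
Qed.

Lemma feq_trans a b c p : feq a b p -> feq b c p -> feq a c p.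
Proof.
elim: a b c p => X x IH cx [Y y cy] [Z z cz] p [ab ba] [bc cb].
split=> i q qp qi.
  apply: (dense_below_bind (ab i q qp qi)) => r rq [j rj xy].
  apply: dense_below_mono (bc j r (stronger_trans rq qp) rj) _ => s sr [k sk yz].
  by exists k => //; apply: IH yz; apply: feq_le xy.
apply: (dense_below_bind (cb i q qp qi)) => r rq [j rj yz].
apply: dense_below_mono (ba j r (stronger_trans rq qp) rj) _ => s sr [k sk xy].
by exists k => //; apply: IH xy _; apply: feq_le yz.
Qed.

Lemma fmem_le a b p q : q ≼ p -> fmem a b p -> fmem a b q.
Proof. by case: b => Y y d qp; apply: dense_below_le. Qed.

Lemma fmem_dense a b p : dense_below p (fmem a b) -> fmem a b p.
Proof. by case: b => Y y d; apply: dense_below_dense. Qed.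

Lemma fmem_feql a a' b p : feq a a' p -> fmem a b p -> fmem a' b p.
Proof.
case: b => Y y d aa' ab; apply: dense_below_mono ab _ => r rp [j rj ay].
by exists j => //; apply: feq_trans ay; apply: feq_sym; apply: feq_le aa'.
Qed.

Lemma fmem_feqr a b b' p : feq b b' p -> fmem a b p -> fmem a b' p.
Proof.
case: b b' => [Y y d] [Z z e] [bb' _] ab.
apply: (dense_below_bind ab) => r rp [j rj ay].
apply: dense_below_mono (bb' j r rp rj) _ => s sr [k sk yz].
by exists k => //; apply: feq_trans yz; apply: feq_le ay.
Qed.

Lemma nupair_feq a b a' b' p :
  feq a a' p -> feq b b' p -> feq (nupair a b) (nupair a' b') p.
Proof.
move=> aa' bb'; split=> u q qp _; apply: dense_below_now => r rq;
  exists u; (try exact: stronger_top);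
  by case: u; [apply: feq_le aa'|apply: feq_le bb']; exact: stronger_trans rq qp.
Qed.

Lemma npair_feq a b a' b' p :
  feq a a' p -> feq b b' p -> feq (npair a b) (npair a' b') p.
Proof. by move=> aa' bb'; do 2?apply: nupair_feq. Qed.

(** Equality of unordered pairs is a disjunction, and a disjunction that is
    forced is only decided by a dense set of stronger conditions. *)
Lemma nupair_inj a b a' b' p : feq (nupair a b) (nupair a' b') p ->
  dense_below p (fun r => (feq a a' r /\ feq b b' r) \/
                          (feq a b' r /\ feq b a' r)).
Proof.
move=> [ab ba].
have top_ q : q ≼ top := stronger_top q.
have lek q r : r ≼ q -> q ≼ p -> r ≼ p by exact: stronger_trans.
apply: (dense_below_bind (ab true p (stronger_refl p) (top_ _))) => q1 q1p.
move=> [u _ au].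
apply: (dense_below_bind (ab false q1 q1p (top_ _))) => q2 q21 [v _ bv].
have q2p := lek _ _ q21 q1p.
apply: (dense_below_bind (ba true q2 q2p (top_ _))) => q3 q32 [w _ aw].
have q3p := lek _ _ q32 q2p.
apply: (dense_below_mono (ba false q3 q3p (top_ _))) => q4 q43 [z _ bz].
have {}aw := feq_le q43 aw.
have {}bv := feq_le (stronger_trans q43 q32) bv.
have {}au := feq_le (stronger_trans (stronger_trans q43 q32) q21) au.
case: u au => au; case: v bv => bv; [|by left|by right|].
  case: z bz => bz; last by left.
  by left; split => //; apply: feq_trans (bv) (feq_trans (feq_sym au) bz).
case: w aw => aw; last by right.
by left; split => //; apply: feq_trans (au) (feq_trans (feq_sym bv) aw).
Qed.

Lemma npair_inj a b a' b' p : feq (npair a b) (npair a' b') p ->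
  feq a a' p /\ feq b b' p.
Proof.
move=> E; suff D : dense_below p (fun r => feq a a' r /\ feq b b' r).
  by split; apply: feq_dense; apply: dense_below_mono D _ => r _ [].
apply: (dense_below_bind (nupair_inj E)) => r rp [] [E1 E2].
  apply: (dense_below_bind (nupair_inj E1)) => s sr D1.
  have {D1} aa' : feq a a' s by case: D1 => [] [].
  apply: (dense_below_mono (nupair_inj (feq_le sr E2))) => t ts.
  have {}aa' := feq_le ts aa'.
  case=> [] [ab ba]; first by split.
  by split=> //; apply: feq_trans ba (feq_trans (feq_sym aa') ab).
apply: (dense_below_bind (nupair_inj E1)) => s sr D1.
have {D1} [aa' ab'] : feq a a' s /\ feq a b' s by case: D1 => [] [].
apply: (dense_below_mono (nupair_inj (feq_le sr E2))) => t ts D2.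
have ba' : feq b a' t by case: D2 => [] [].
have {}aa' := feq_le ts aa'; split => //.
by apply: feq_trans ba' (feq_trans (feq_sym aa') (feq_le ts ab')).
Qed.

End ForcingTheory.

(** * Check names *)

Definition gelem (x y : gset) : Prop := let: GSet X e := y in exists i, x = e i.

Lemma gelem_gnat x n : gelem x (gnat n) <-> exists2 k, k < n & x = gnat k.
Proof.
elim: n x => [|n IH] x /=; first by split=> [[[]]|[]].
case E: (gnat n) IH => [X e] /= IH; split=> [[[i|] ->]|[k + ->]].
- by have [k kn ->] := (IH (e i)).1 (ex_intro _ i erefl); exists k => //;
    apply: ltnW.
- by exists n; rewrite ?leqnn ?E.
rewrite ltnS leq_eqVlt => /predU1P[->|kn]; first by exists None; rewrite E.
by have [i ->] := (IH (gnat k)).2 (ex_intro2 _ _ k kn erefl); exists (Some i).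
Qed.

Lemma gelem_gsubset x A : gelem x (gsubset A) <-> exists2 k, A k & x = gnat k.
Proof.
by split=> [[[k Ak] ->]|[k Ak ->]]; [exists k | exists (exist _ k Ak)].
Qed.

Section CheckNames.
Variable P : forcing_notion.
Implicit Types (p q r : P) (a b c f : name P).

Lemma check_gpair (x y : gset) :
  check P (gpair x y) = npair (check P x) (check P y).
Proof.
rewrite /gpair /npair /gupair /nupair /=.
by congr Name; apply/funext => -[]; congr Name; apply/funext => -[].
Qed.

Lemma fmem_check a (x : gset) p : fmem a (check P x) p <->
  dense_below p (fun r => exists2 y, gelem y x & feq a (check P y) r).
Proof.
case: x => X e /=; split=> D; apply: dense_below_mono D _ => r _.
  by move=> [i _ E]; exists (e i) => //; exists i.
by move=> [_ [i ->] E]; exists i => //; exact: stronger_top.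
Qed.

(** By foundation: if a check name of [x] is forced into itself, then the same
    holds of some element of [x]. *)
Lemma check_notin_self (x : gset) p : ~ fmem (check P x) (check P x) p.
Proof.
elim: x p => X e IH p H.
have /fmem_check/dense_below_ex[q _ [_ [i ->] E]] := H.
apply: (IH i q); apply: fmem_feqr E _; apply/fmem_check.
by apply: dense_below_now => r _; exists (e i); [exists i|exact: feq_refl].
Qed.

(** Of two distinct naturals one is an element of the other. *)
Lemma check_gnat_inj m n p :
  feq (check P (gnat m)) (check P (gnat n)) p -> m = n.
Proof.
suff lt i j r : i < j -> ~ feq (check P (gnat i)) (check P (gnat j)) r.
  move=> E; case: (ltngtP m n) => // [/lt /(_ E)|/lt /(_ (feq_sym E))] [].
move=> ij /feq_sym E; apply: (@check_notin_self (gnat i) r).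
apply: fmem_feqr E _; apply/fmem_check; apply: dense_below_now => s _.
by exists (gnat i); [apply/gelem_gnat; exists i | exact: feq_refl].
Qed.

Lemma fmem_nomega a p : fmem a (nomega P) p <->
  dense_below p (fun r => exists n, feq a (check P (gnat n)) r).
Proof.
rewrite /nomega fmem_check; split=> D; apply: dense_below_mono D _ => r _.
  by move=> [_ [n ->] E]; exists n.
by move=> [n E]; exists (gnat n) => //; exists n.
Qed.

Lemma gnat_in_nomega n p : fmem (check P (gnat n)) (nomega P) p.
Proof.
by apply/fmem_nomega/dense_below_now => q _; exists n; exact: feq_refl.
Qed.
Arguments gnat_in_nomega : clear implicits.

(** The condition forces f(n) = i, for f a name of a function. *)
Definition fvalue f (n i : nat) : formula P :=
  fmem (npair (check P (gnat n)) (check P (gnat i))) f.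

Lemma fmem_gfun n s (h : nat -> gset) p :
  fmem (npair (check P (gnat n)) s) (check P (gfun h)) p <->
  feq s (check P (h n)) p.
Proof.
rewrite fmem_check; split=> [D|E].
  apply: feq_dense; apply: dense_below_mono D _ => r _ [_ [k ->]].
  by rewrite check_gpair => /npair_inj[/check_gnat_inj <-].
apply: dense_below_now => r rp; exists (gpair (gnat n) (h n)); first by exists n.
by rewrite check_gpair; apply: npair_feq (feq_refl _ _) (feq_le rp E).
Qed.

(** The names for n, f(n) and h(n) hidden in the formula can all be traded,
    densely, for check names of naturals and of h(n). *)
Lemma pointwise_in_gfun f (h : nat -> gset) (H : nat -> set nat) p :
  (forall n x, gelem x (h n) <-> exists2 k, H n k & x = gnat k) ->
  forces p (pointwise_in f (check P (gfun h))) <->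
  forall n, dense_below p (fun r => exists2 i, H n i & fvalue f n i r).
Proof.
move=> hH; split=> [fh n|fH n q qp /fmem_nomega nom].
  have := fh (check P (gnat n)) p (stronger_refl p) (gnat_in_nomega n p).
  move=> /dense_below_bind; apply=> q qp [m Dm].
  apply: (dense_below_bind Dm) => r rq [s [nmf [/fmem_gfun sh ms]]].
  have /fmem_check := fmem_feqr sh ms.
  move=> /dense_below_mono; apply=> t tr [_ /hH[k Hk ->] mk].
  exists k => //; apply: fmem_feql _ (fmem_le tr nmf).
  exact: npair_feq (feq_refl _ _) mk.
apply: (dense_below_bind nom) => r rq [k nk].
have rp := stronger_trans rq qp.
apply: (dense_below_mono (dense_below_le rp (fH k))) => s sr [i Hi ki].
have nks := feq_sym (feq_le sr nk).
exists (check P (gnat i)) => t ts; exists t; first exact: stronger_refl.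
exists (check P (h k)); split; last split.
- by apply: fmem_le ts _; apply: fmem_feql ki;
    exact: npair_feq nks (feq_refl _ _).
- apply: fmem_le ts _; apply: 
    (@fmem_feql _ (npair (check P (gnat k)) (check P (h k)))).
    exact: npair_feq nks (feq_refl _ _).
  by apply/fmem_gfun/feq_refl.
- apply/fmem_check/dense_below_now => u _.
  by exists (gnat i); [apply/hH; exists i | exact: feq_refl].
Qed.

Lemma pointwise_in_check_fun f g p :
  forces p (pointwise_in f (check_fun P g)) <->
  forall n, dense_below p (fun r => exists2 i, i < g n & fvalue f n i r).
Proof.
by apply: (pointwise_in_gfun _ (H := fun n => `I_(g n))) => n x; exact: gelem_gnat.
Qed.

Lemma pointwise_in_check_slalom f g (S : slalom g) p :
  forces p (pointwise_in f (check_slalom P S)) <->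
  forall n, dense_below p (fun r => exists2 i, sval S n i & fvalue f n i r).
Proof. by apply: pointwise_in_gfun => n x; exact: gelem_gsubset. Qed.

Lemma fvalue_inj f n i j p : forces top (in_omega_omega f) ->
  fvalue f n i p -> fvalue f n j p -> i = j.
Proof.
move=> [_ /(_ _ p (stronger_top p) (gnat_in_nomega n p)) /dense_below_ex].
move=> [q qp [m [_ [_ uniq]]]] fi fj.
have E k : fvalue f n k p -> feq (check P (gnat k)) m q.
  by move=> fk; apply: uniq (stronger_refl q) (fmem_le qp fk).
exact: check_gnat_inj (feq_trans (E i fi) (feq_sym (E j fj))).
Qed.

Section FunctionName.
Variables (I : Type) (arg val : I -> nat) (c : I -> P).

(** A function in the extension, presented by conditions [c i] each of which
    decides the value [val i] at the argument [arg i]. *)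
Definition fun_name : name P :=
  Name (fun i => npair (check P (gnat (arg i))) (check P (gnat (val i)))) c.

Lemma fvalue_fun_name n v p : fvalue fun_name n v p <->
  dense_below p (fun r => exists2 i, r ≼ c i & arg i = n /\ val i = v).
Proof.
split=> D; apply: dense_below_mono D _ => r _ [i ri].
  by move=> /npair_inj[/check_gnat_inj-> /check_gnat_inj->]; exists i.
by move=> [<- <-]; exists i => //; exact: feq_refl.
Qed.

Lemma fun_name_in_omega_omega :
  (forall i j r, r ≼ c i -> r ≼ c j -> arg i = arg j -> val i = val j) ->
  (forall n p, exists2 r, r ≼ p & exists2 i, r ≼ c i & arg i = n) ->
  forces top (in_omega_omega fun_name).
Proof.
move=> functional total; split=> [z q _ zf|n q _ /fmem_nomega nom].
  apply: (dense_below_mono zf) => r _ [i ri E].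
  exists (check P (gnat (arg i))); split; first exact: gnat_in_nomega.
  apply: dense_below_now => s sr; exists (check P (gnat (val i))).
  by split; [exact: gnat_in_nomega | exact: feq_le sr E].
apply: (dense_below_bind nom) => r rq [k nk].
move=> s sr; have [t ts [i ti ik]] := total k s; exists t => //.
have {}nk := feq_le (stronger_trans ts sr) nk.
exists (check P (gnat (val i))); split; first exact: gnat_in_nomega.
split.
  apply: dense_below_now => u ut; exists i; first exact: stronger_trans ut ti.
  by rewrite ik; apply: npair_feq (feq_le ut nk) (feq_refl _ _).
move=> x u ut ux; apply: feq_dense; apply: (dense_below_mono ux) => v vu [j vj].
have vt := stronger_trans vu ut.
move=> /npair_inj[nj].
have kj := check_gnat_inj (feq_trans (feq_sym (feq_le vt nk)) nj).
by rewrite (functional i j v (stronger_trans vt ti) vj) // ik.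
Qed.

End FunctionName.
End CheckNames.

(** * Laver ultrafilters and bounded functions *)

Lemma card_le_seqP (T : choiceType) (A : set T) (n : nat) :
  A #<= `I_n <-> exists2 l : seq T, size l <= n & A `<=` [set` l].
Proof.
split=> [An|[l ln Al]].
  have /finite_fsetP[X AX] := card_le_finite An (finite_II n).
  exists (finmap.enum_fset X); last by rewrite AX.
  rewrite -card_le_II; apply: card_le_trans An; rewrite AX.
  have /card_eq_fsetP := erefl (size (finmap.enum_fset X)).
  by rewrite card_eq_sym => /card_eqPle[].
apply: card_le_trans (subset_card_le Al) _.
case: l ln {Al} => [|x0 l] ln; first by rewrite set_nil card_ge0.
apply: (@card_le_trans _ _ _ (nth x0 (x0 :: l) @` `I_n));
  last exact: card_image_le.
apply: subset_card_le => x /= xl.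
exists (index x (x0 :: l)); last exact: nth_index.
by apply: leq_trans ln; rewrite index_mem.
Qed.

Lemma ultra_pigeonhole (U : set_system nat) (A : set nat) (w : nat -> nat) N :
  UltraFilter U -> U A -> (forall m, A m -> w m < N) ->
  exists2 i, i < N & U (A `&` [set m | w m = i]).
Proof.
move=> UU; elim: N A => [|N IH] A UA wN.
  by have [m /wN] := filter_ex UA.
have [UE|UC] := in_ultra_setVsetC [set m | w m = N] UU.
  by exists N => //; apply: filterI.
have [||i iN Ui] := IH (A `&` ~` [set m | w m = N]); first exact: filterI.
  by move=> m [/wN + /eqP]; rewrite ltnS leq_eqVlt => /predU1P[->|//]; rewrite eqxx.
by exists i; [exact: ltnW | apply: filterS Ui => m [[]]].
Qed.

(** Partitions are the classes of bounded functions, and conversely a finite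
    partition is numbered by the position of a piece in a list. *)
Lemma laver_ultrafilterP (U : set_system nat) :
  laver_ultrafilter U <->
  forall (g : nat -> nat) (w : nat -> nat -> nat),
    (forall m n, w m n < g n) ->
    exists2 x, U x & forall n,
      exists2 l : seq nat, size l <= n.+1 & forall m, x m -> w m n \in l.
Proof.
split=> [L g w wg|L P Ppart].
  pose cls n m := [set m' | w m' n = w m n].
  have [n|x Ux xP] := L (fun n => range (cls n)).
    split.
      apply: (@sub_finite_set _ _ ((fun i => [set m | w m n = i]) @` `I_(g n))).
        by move=> _ [m _ <-]; exists (w m n) => //; exact: wg.
      exact/finite_image/finite_II.
    split.
    - by rewrite predeqE => m; split=> // _; exists (cls n m); [exists m|].
    - move=> _ _ [i _ <-] [j _ <-] [m [mi mj]].
      by rewrite /cls; have <- : w m n = w i n := mi; have <- : w m n = w j n := mj.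
    - by move=> _ [m _ <-]; exists m.
  exists x => // n; have /card_le_seqP[l ln xl] := xP n.
  exists [seq w (xget 0 A) n | A <- l]; first by rewrite size_map.
  move=> m xm; apply/mapP; exists (cls n m).
    by apply: xl; split; [exists m | exists m].
  by have /= -> := xgetI 0 (erefl : cls n m m).
have /choice[l lP] n : exists l : seq (set nat), P n = [set` l].
  by have [/finite_seqP] := Ppart n.
pose w m n := find (fun A => m \in A) (l n).
have has_piece m n : has (fun A => m \in A) (l n).
  have [_ [cov _ _]] := Ppart n; have : cover (P n) id m by rewrite cov.
  by move=> [A PA Am]; apply/hasP; exists A; [rewrite lP in PA | rewrite inE].
have wE m n A : P n A -> A m -> A = nth set0 (l n) (w m n).
  move=> PA Am; have [_ [_ triv _]] := Ppart n.
  apply: triv => //; first by rewrite lP /= mem_nth // -has_find.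
  by exists m; split=> //; have := nth_find set0 (has_piece m n); rewrite inE.
have [m n|x Ux xP] := L (fun n => size (l n)) w; first by rewrite -has_find.
exists x => // n; apply/card_le_seqP; have [s sn xs] := xP n.
exists (map (nth set0 (l n)) s); first by rewrite size_map.
by move=> A [PA [m [xm Am]]]; apply/mapP; exists (w m n); [exact: xs|exact: wE].
Qed.

(** Mixed radix notation, with digits [u 0], ..., [u k.-1] in the bases
    [g 0], ..., [g k.-1]; it packs finitely many bounded values into one. *)
Fixpoint code (g : nat -> nat) k (u : nat -> nat) : nat :=
  if k is j.+1 then code g j u * g j + u j else 0.

Fixpoint decode (g : nat -> nat) k (c : nat) (n : nat) : nat :=
  if k is j.+1 then if n == j then c %% g j else decode g j (c %/ g j) n else 0.

Lemma code_lt g k u : (forall n, n < k -> u n < g n) ->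
  code g k u < \prod_(i < k) g i.
Proof.
elim: k => [|k IH] ug /=; first by rewrite big_ord0.
rewrite big_ord_recr /=; have uk := ug k (leqnn _).
have {}IH := IH (fun n nk => ug n (ltnW nk)).
by apply: leq_trans (leq_mul IH (leqnn (g k))); rewrite mulSn addnC -addSn leq_add2r.
Qed.

Lemma codeK g k u n : (forall n, n < k -> u n < g n) -> n < k ->
  decode g k (code g k u) n = u n.
Proof.
elim: k => [//|k IH] ug nk /=; have uk := ug k (leqnn _).
have [->|nNk] := eqVneq n k; first by rewrite modnMDl modn_small.
rewrite divnMDl ?(leq_ltn_trans _ uk) // divn_small // addn0 IH //.
  by move=> j jk; apply: ug; apply: ltnW.
by rewrite ltn_neqAle nNk.
Qed.

(** The number of values can be made to grow [d] times as slowly: apply the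
    Laver property of [U] to the functions coding, for each [k], all the values
    at arguments [n < k.+1 * d].  The limit along [U] is always taken on a large
    set, so excluding it from the count turns [(n %/ d).+1] into [n %/ d]. *)
Lemma laver_slow_values (U : set_system nat) (g : nat -> nat)
    (w : nat -> nat -> nat) (lim : nat -> nat) d :
  UltraFilter U -> laver_ultrafilter U -> 0 < d ->
  (forall m n, w m n < g n) -> (forall n, U [set m | w m n = lim n]) ->
  exists2 x, U x & forall n, exists2 l : seq nat,
    size l <= n %/ d & forall m, x m -> w m n \in lim n :: l.
Proof.
move=> UU /laver_ultrafilterP L d0 wg wlim.
have [|x Ux xP] := L (fun k => \prod_(i < k.+1 * d) g i)
  (fun m k => code g (k.+1 * d) (w m)).
  by move=> m k; apply: code_lt => n _.
exists x => // n; have [l ln xl] := xP (n %/ d).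
pose vals := [seq decode g ((n %/ d).+1 * d) c n | c <- l].
have xvals m : x m -> w m n \in vals.
  move=> xm; apply/mapP; exists (code g ((n %/ d).+1 * d) (w m)); first exact: xl.
  by rewrite codeK // ltn_ceil.
have lim_in : lim n \in vals.
  by have [m [xm <-]] := filter_ex (filterI Ux (wlim n)); exact: xvals.
exists (rem (lim n) vals); first by rewrite size_rem // size_map -subn1 leq_subLR.
by move=> m /xvals; rewrite (perm_mem (perm_to_rem lim_in)).
Qed.

(** * Laver trees with a given stem *)

(** The Laver trees with stem [s]: for a nonprincipal ultrafilter, nodes above
    [s] branch, so [s] is the longest node compatible with all others
    ([laver_treeP]). *)
Definition laver_at (U : set_system nat) (s : seq nat) (T : set (seq nat)) : Prop :=
  [/\ T s, forall u v, prefix u v -> T v -> T u, forall t, T t -> compatible s t &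
      forall t, T t -> prefix s t -> U (succ_in T t)].


Lemma compatible_refl s : compatible s s.
Proof. by rewrite /compatible prefix_refl. Qed.

Lemma compatible_sym s t : compatible s t = compatible t s.
Proof. by rewrite /compatible orbC. Qed.

Lemma prefix_compatible u t s : prefix u s -> prefix t s -> compatible u t.
Proof.
wlog ut : u t / size u <= size t => [W|].
  by case: (leqP (size u) (size t)) => [|/ltnW] le us ts;
    [apply: W | rewrite compatible_sym; apply: W].
rewrite /compatible prefixE => /eqP us; rewrite prefixE => /eqP ts.
by rewrite prefixE -{1}ts take_takel ?us ?eqxx.
Qed.

Lemma compatible_prefixl u s t : prefix u s -> compatible s t -> compatible u t.
Proof.
move=> us /orP[st|ts]; first by rewrite /compatible (prefix_trans us st).
exact: prefix_compatible us ts.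
Qed.

Lemma compatible_size u t : compatible u t -> size u <= size t -> prefix u t.
Proof.
move=> /orP[//|/prefixP[x ->]].
rewrite size_cat -{2}(addn0 (size t)) leq_add2l leqn0.
by move=> /nilP->; rewrite cats0 prefix_refl.
Qed.

Lemma compatible_eq s t u : compatible s u -> compatible t u ->
  size s = size t -> size s <= size u -> s = t.
Proof.
move=> su tu st le; have := compatible_size su le.
have := compatible_size tu; rewrite -st => /(_ le); rewrite !prefixE st.
by move=> /eqP E /eqP; rewrite E.
Qed.


Lemma compatible_child (s t : seq nat) : t != s ->
  prefix s t -> exists m, prefix (rcons s m) t.
Proof.
move=> ts /prefixP[[|m v] tE]; first by rewrite tE cats0 eqxx in ts.
by exists m; rewrite tE -cat_rcons prefix_prefix.
Qed.

Lemma rcons_compatible_inj s m m' t : compatible (rcons s m) t ->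
  prefix (rcons s m') t -> m = m'.
Proof.
move=> c p; suff /rcons_inj[] : rcons s m = rcons s m' by [].
by apply: (compatible_eq c (t := rcons s m')); rewrite ?size_rcons //;
  [rewrite /compatible p | have := size_prefix p; rewrite size_rcons].
Qed.

Section LaverTrees.
Variables (U : set_system nat) (UU : UltraFilter U).
Hypothesis Unp : nonprincipal U.

Lemma ultra_other (A : set nat) a : U A -> exists2 b, A b & b != a.
Proof.
move=> UA; apply: contrapT => nb; apply: (Unp (n := a)).
apply: filterS UA => b Ab.
by apply: contrapT => ba; apply: nb; exists b => //; apply/eqP.
Qed.

Lemma laver_at_node s T : laver_at U s T -> T s.
Proof. by case. Qed.

(** A node strictly below the stem branches, and only one of its successors is
    compatible with the stem. *)
Lemma laver_at_le s t T R : laver_at U s T -> laver_at U t R -> R `<=` T ->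
  prefix s t.
Proof.
move=> [_ _ Ts _] [Rt _ _ Rsucc] RT.
have := Ts t (RT t Rt); case/orP => // ts.
have [->|tNs] := eqVneq s t; first exact: prefix_refl.
have [a sa] := compatible_child tNs ts.
have [b Rb ba] := ultra_other a (Rsucc t Rt (prefix_refl t)).
have /rcons_compatible_inj /(_ sa) E : compatible (rcons t b) s.
  by rewrite compatible_sym; apply: Ts; apply: RT.
by rewrite E eqxx in ba.
Qed.

Lemma laver_treeP T : laver_tree U T <-> exists s, laver_at U s T.
Proof.
split=> [[[_ Tp] [s [[Ts Tc] _] succT]]|[s Tat]].
  by exists s; split=> // u v uv; apply: Tp.
have [Ts Tp Tc Tsucc] := Tat; split.
  by split; [exists s | move=> u v uv Tv; apply: Tp Tv].
exists s => //; split; first by split.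
move=> u [Tu uc]; case: (leqP (size u) (size s)) => // su.
have us := compatible_size (Tc u Tu) (ltnW su).
have Tu_at : laver_at U u T.
  by split=> // t Tt ut; apply: Tsucc => //; apply: prefix_trans us ut.
by have := size_prefix (laver_at_le Tu_at Tat (@subset_refl _ T)); rewrite leqNgt su.
Qed.

(** The nodes compatible with [t]: for [t] above the stem, the tree with its stem
    prolonged to [t]. *)
Definition subtree (T : set (seq nat)) (t : seq nat) : set (seq nat) :=
  [set u | T u /\ compatible t u].

Lemma laver_at_subtree s t T : laver_at U s T -> T t -> prefix s t ->
  laver_at U t (subtree T t).
Proof.
move=> [Ts Tp Tc Tsucc] Tt st; split.
- by split=> //; exact: compatible_refl.
- move=> u v uv [Tv tv]; split; first exact: Tp Tv.
  by rewrite compatible_sym; apply: compatible_prefixl uv _; rewrite compatible_sym.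
- by move=> u [].
- move=> u [Tu _] tu; apply: filterS (Tsucc u Tu (prefix_trans st tu)) => m Tm.
  by split=> //; rewrite /compatible (prefix_trans tu) ?prefix_rcons.
Qed.

Lemma laver_atI s T R : laver_at U s T -> laver_at U s R ->
  laver_at U s (T `&` R).
Proof.
move=> [Ts Tp Tc Tsucc] [Rs Rp Rc Rsucc]; split=> //.
- by move=> u v uv [Tv Rv]; split; [apply: Tp Tv|apply: Rp Rv].
- by move=> t [/Tc].
- by move=> t [Tt Rt] st; apply: filterI (Tsucc t Tt st) (Rsucc t Rt st).
Qed.

Lemma laver_at_glue s (A : set nat) (R : nat -> set (seq nat)) : U A ->
  (forall m, A m -> laver_at U (rcons s m) (R m)) ->
  laver_at U s (\bigcup_(m in A) R m).
Proof.
move=> UA RA; have [a Aa] := filter_ex UA.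
have tree_ m : A m -> forall u v, prefix u v -> R m v -> R m u.
  by move=> /RA[].
split.
- exists a => //; apply: (tree_ a Aa _ _ (prefix_rcons s a)).
  exact: laver_at_node (RA a Aa).
- by move=> u v uv [m Am Rv]; exists m => //; apply: (tree_ m Am u v).
- move=> t [m Am Rt]; apply: compatible_prefixl (prefix_rcons s m) _.
  by have [_ _ + _] := RA m Am; apply.
move=> t [m Am Rt] st; have [_ _ Rc Rsucc] := RA m Am.
have [->|ts] := eqVneq t s.
  by apply: filterS UA => b Ab; exists b => //; exact: laver_at_node (RA b Ab).
have [b bt] := compatible_child ts st.
have mb := rcons_compatible_inj (Rc t Rt) bt.
by rewrite -mb in bt; apply: filterS (Rsucc t Rt bt) => k Rk; exists m.
Qed.

(** Every tree below a glued tree meets one of the pieces: pass to a node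
    strictly above the common stem. *)
Lemma laver_at_below_glue s t (A : set nat) (R : nat -> set (seq nat)) Q :
  (forall m, A m -> laver_at U (rcons s m) (R m)) ->
  laver_at U t Q -> prefix s t -> Q `<=` \bigcup_(m in A) R m ->
  exists2 m, A m & exists2 t', Q t' /\ prefix t t' & subtree Q t' `<=` R m.
Proof.
move=> RA [Qt Qp Qc Qsucc] st QR.
have [k Qk] := filter_ex (Qsucc t Qt (prefix_refl t)).
have [m Am Rk] := QR _ Qk; have [_ Rp Rc _] := RA m Am.
have tk : prefix t (rcons t k) by exact: prefix_rcons.
have sk : size (rcons s m) <= size (rcons t k).
  by rewrite !size_rcons; exact: size_prefix st.
have smk := compatible_size (Rc _ Rk) sk.
exists m => //; exists (rcons t k) => // u [Qu /orP[ku|uk]]; last exact: Rp uk Rk.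
have [m' Am' Rm'u] := QR u Qu; have [_ _ Rc' _] := RA m' Am'.
by rewrite -(rcons_compatible_inj (Rc' u Rm'u) (prefix_trans smk ku)).
Qed.

Definition prune (s : seq nat) (T : set (seq nat)) (X : seq nat -> set nat) :
    set (seq nat) :=
  [set t | T t /\ forall u m, prefix s u -> prefix (rcons u m) t -> X u m].

Lemma laver_at_prune s T X : laver_at U s T ->
  (forall u, T u -> prefix s u -> U (X u)) -> laver_at U s (prune s T X).
Proof.
move=> [Ts Tp Tc Tsucc] UX; split.
- split=> // u m su /size_prefix; rewrite size_rcons ltnNge.
  by rewrite (size_prefix su).
- move=> u v uv [Tv vX]; split; first exact: Tp Tv.
  by move=> w m sw wu; apply: vX (prefix_trans wu uv).
- by move=> t [/Tc].
move=> t [Tt tX] st.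
apply: filterS (filterI (Tsucc t Tt st) (UX t Tt st)) => m [Tm Xm].
split=> // u k su uk; have [/eqP|uNt] := eqVneq (rcons u k) (rcons t m).
  by rewrite eqseq_rcons => /andP[/eqP-> /eqP->].
apply: tX => //; apply: compatible_size; last first.
  have := size_prefix uk; rewrite [X in _ <= X]size_rcons leq_eqVlt.
  move=> /predU1P[E|//].
  case/negP: uNt; apply/eqP; apply: (compatible_eq (u := rcons t m)) => //;
    by rewrite /compatible ?uk ?prefix_refl // E ?size_rcons.
exact: prefix_compatible uk (prefix_rcons t m).
Qed.

Lemma laver_at_ind s T (H : seq nat -> Prop) : laver_at U s T -> H s ->
  (forall t m, T t -> T (rcons t m) -> prefix s t -> H t -> H (rcons t m)) ->
  forall t, T t -> prefix s t -> H t.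
Proof.
move=> [_ Tp _ _] Hs step t + /prefixP[v tE]; rewrite {}tE.
elim/last_ind: v => [|v m IH]; first by rewrite cats0.
rewrite -rcons_cat => Tm.
have Tv : T (s ++ v) by apply: Tp Tm; exact: prefix_rcons.
by apply: step => //; [exact: prefix_prefix|exact: IH].
Qed.

Lemma laver_at_long s T n : laver_at U s T ->
  exists2 t, T t & prefix s t /\ n <= size t.
Proof.
move=> [Ts _ _ Tsucc]; elim: n => [|n [t Tt [st nt]]].
  by exists s; rewrite ?prefix_refl.
have [m Tm] := filter_ex (Tsucc t Tt st).
exists (rcons t m) => //; split; last by rewrite size_rcons.
exact: prefix_trans st (prefix_rcons t m).
Qed.

Lemma laver_at_cone t : laver_at U t [set u | compatible t u].
Proof.
split=> //; first exact: compatible_refl.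
  move=> u v uv /=; rewrite compatible_sym => vt.
  by rewrite compatible_sym; apply: compatible_prefixl uv vt.
move=> u _ tu; apply: filterS filterT => m _.
by rewrite /succ_in /= /compatible (prefix_trans tu) ?prefix_rcons.
Qed.

End LaverTrees.

(** * Pure decision *)

Section LaverConditions.
Variables (U : set_system nat) (UU : UltraFilter U).
Hypothesis Unp : nonprincipal U.
Local Notation LU := (laver_forcing UU).

Definition laver_at_cond s T (H : laver_at U s T) : LU :=
  exist _ T ((laver_treeP UU Unp T).2 (ex_intro _ s H)).

Lemma cond_laver_at (p : LU) : exists s, laver_at U s (sval p).
Proof. exact: (laver_treeP UU Unp _).1 (svalP p). Qed.

(** Call a node bad if no condition with that stem decides.  If
    almost all successors of a node were not bad, almost all of them would decide
    the same way, and glueing would decide at the node itself; so below a bad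
    node, almost all successors are bad.  If the stem were bad, then a tree of
    bad nodes could be grown from it, and nothing below that tree would decide.
    Here almost all means for a set in [U]. *)
Lemma pure_decision (D : nat -> formula LU) N (p : LU) s :
  (forall i q r, r ≼ q -> D i q -> D i r) ->
  (forall i q, dense_below q (D i) -> D i q) ->
  (forall q, exists2 r, r ≼ q & exists2 i, i < N & D i r) ->
  laver_at U s (sval p) ->
  exists2 i, i < N & exists2 q, q ≼ p & laver_at U s (sval q) /\ D i q.
Proof.
move=> mono local total ps; apply: contrapT => bads.
pose bad t :=
    ~ exists2 i, i < N & exists2 q, q ≼ p & laver_at U t (sval q) /\ D i q.
pose X t := [set m | bad t -> bad (rcons t m)].
have UX t : sval p t -> prefix s t -> U (X t).
  move=> pt st; have [//|UXC] := in_ultra_setVsetC (X t) UU; exfalso.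
  have /choice[iq iqP] m : exists iq : nat * LU, (~` X t) m ->
      [/\ iq.1 < N, iq.2 ≼ p, laver_at U (rcons t m) (sval iq.2) & D iq.1 iq.2].
    have [Xm|XCm] := pselect ((~` X t) m); last by exists (0, p).
    have [i iN [q qp [qm Di]]] : exists2 i, i < N & exists2 q, q ≼ p &
        laver_at U (rcons t m) (sval q) /\ D i q.
      by apply: contrapT => nq; apply: Xm => _.
    by exists (i, q).
  have [i iN Ui] : exists2 i, i < N & U (~` X t `&` [set m | (iq m).1 = i]).
    by apply: ultra_pigeonhole => // m /iqP[].
  pose glued := \bigcup_(m in ~` X t `&` [set m | (iq m).1 = i]) sval (iq m).2.
  have gl : laver_at U t glued.
    by apply: (laver_at_glue UU Ui (R := fun m => sval (iq m).2)) => m [/iqP[]].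
  have badt : bad t.
    have [m Xm] := filter_ex UXC; apply: contrapT => nb; apply: Xm => bt.
    by case: nb.
  apply: badt; exists i => //; exists (laver_at_cond gl).
    by move=> u [m [/iqP[_ qp _ _] _] /qp].
  split=> //; apply: local => r rgl.
  have [t' rt'] := cond_laver_at r.
  have tt' := laver_at_le UU Unp gl rt' rgl.
  have [|m [Xm im] [v [rv t'v] rvm]] := laver_at_below_glue UU _ rt' tt' rgl.
    by move=> m [/iqP[]].
  exists (laver_at_cond (laver_at_subtree UU rt' rv t'v)); first by move=> u [].
  by have [_ _ _] := iqP m Xm; rewrite im; apply: mono.
have T' := laver_at_prune UU ps UX.
have [q qT' [i iN Di]] := total (laver_at_cond T').
have [t qt] := cond_laver_at q.
have st := laver_at_le UU Unp T' qt qT'.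
have T't : prune s (sval p) X t by apply: qT'; exact: laver_at_node qt.
have : bad t.
  apply: (laver_at_ind T' _ _ T't st) => // u m _ [_ /(_ u m)] + su.
  by apply; rewrite ?prefix_refl.
by apply; exists i => //; exists q => //; apply: subset_trans qT' _ => u [].
Qed.

End LaverConditions.

(** * From Laver ultrafilters to the Laver property *)

Lemma sum_halves n k : \sum_(j < k) n %/ 2 ^ j.+1 + n %/ 2 ^ k <= n.
Proof.
elim: k => [|k IH]; first by rewrite big_ord0 divn1.
apply: leq_trans IH; rewrite big_ord_recr /= -addnA leq_add2l.
by rewrite expnSr divnMA addnn -muln2 leq_trunc_div.
Qed.

Section LaverToProperty.
Variables (U : set_system nat) (UU : UltraFilter U).
Hypotheses (Unp : nonprincipal U) (UL : laver_ultrafilter U).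
Local Notation LU := (laver_forcing UU).

(** Thin the successors of each node [s] so that they contribute at most
    [n %/ 2 ^ (pickle s).+1] values at [n] other than the value at [s].  For
    [pickle s >= n] this is none, so the values at [n] over the whole tree are
    those at [s0] and the contributions of the nodes numbered below [n], which
    [sum_halves] counts. *)
Lemma laver_prune_values (s0 : seq nat) (T : set (seq nat)) (g : nat -> nat)
    (v : seq nat -> nat -> nat) :
  laver_at U s0 T -> (forall s n, v s n < g n) ->
  (forall s n, T s -> prefix s0 s -> U [set m | v (rcons s m) n = v s n]) ->
  exists2 T', laver_at U s0 T' /\ T' `<=` T & forall n,
    exists2 l : seq nat, size l <= n.+1 &
      forall t, T' t -> prefix s0 t -> v t n \in l.
Proof.
move=> Tat vg vlim.
have /choice[xl xlP] s : exists xl : set nat * (nat -> seq nat),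
    (forall n, size (xl.2 n) <= n %/ 2 ^ (pickle s).+1) /\
    (T s -> prefix s0 s -> U xl.1 /\
      forall n m, xl.1 m -> v (rcons s m) n \in v s n :: xl.2 n).
  have [[Ts s0s]|ns] := pselect (T s /\ prefix s0 s); last first.
    by exists (setT, fun=> [::]); split=> // Ts s0s; case: ns.
  have [|||x Ux /choice_exists2[l ll xl]] := @laver_slow_values U g
      (fun m => v (rcons s m)) (v s) (2 ^ (pickle s).+1) UU UL.
  - by rewrite expn_gt0.
  - by [].
  - by move=> n; exact: vlim.
  by exists (x, l); split=> // _ _; split=> // n m; exact: xl.
have UX u : T u -> prefix s0 u -> U (xl u).1 by move=> Tu /((xlP u).2 Tu)[].
exists (prune s0 T (fun u => (xl u).1)); first split.
- exact: laver_at_prune.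
- by move=> u [].
move=> n.
(* [unpickle] is only a partial inverse: the test discards spurious codes. *)
pose L j := if unpickle j is Some s then
  if pickle s == j then (xl s).2 n else [::] else [::].
exists (v s0 n :: flatten [seq L j | j <- iota 0 n]).
  rewrite /= ltnS size_flatten /shape -map_comp sumnE big_map.
  rewrite -{1}(subn0 n) -/(index_iota 0 n) big_mkord.
  apply: leq_trans (sum_halves n n); apply: leq_trans (leq_addr _ _).
  apply: leq_sum => j _; rewrite /= /L; case: unpickle => // s.
  by case: eqP => // <-; have [+ _] := xlP s; apply.
have T'at := laver_at_prune UU Tat UX.
apply: (laver_at_ind T'at); first by rewrite inE eqxx.
move=> t m [Tt _] [_ T'm] s0t tl.
have /((xlP t).2 Tt)[_ /(_ n m)] := s0t.
rewrite inE => /(_ _)/orP[|/eqP->|tm] //; first exact: T'm (prefix_refl _).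
rewrite inE; apply/orP; right; apply/flatten_mapP; exists (pickle t); last first.
  by rewrite /L pickleK eqxx.
rewrite mem_iota /= add0n; case: ltnP => // nt.
have := (xlP t).1 n; rewrite divn_small; last first.
  by apply: leq_ltn_trans nt (ltn_trans (ltn_expl _ (isT : 1 < 2)) _);
    rewrite ltn_exp2l.
by case: ((xl t).2 n) tm.
Qed.

Lemma laver_property_of_ultrafilter : laver_property LU.
Proof.
move=> f g fom fg p _.
have total n (q : LU) : exists2 r, r ≼ q & exists2 i, i < g n & fvalue f n i r.
  move/pointwise_in_check_fun: fg => /(_ n q (stronger_top q))[r rq [i ig Hi]].
  by exists r => //; exists i.
have [s0 ps0] := cond_laver_at Unp p.
pose val s n i := exists2 q : LU, q ≼ p & laver_at U s (sval q) /\ fvalue f n i q.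
(* Two conditions with the same stem are compatible, their intersection being
   one more. *)
have val_inj s n i j : val s n i -> val s n j -> i = j.
  move=> [q _ [qs Hi]] [r _ [rs Hj]].
  pose qr := laver_at_cond UU Unp (laver_atI UU qs rs).
  apply: (@fvalue_inj LU f n i j qr fom).
    by apply: fmem_le Hi => u [].
  by apply: fmem_le Hj => u [].
have ex_val s n : sval p s -> prefix s0 s -> exists2 i, i < g n & val s n i.
  move=> ps s0s; pose ps_at := laver_at_subtree UU ps0 ps s0s.
  have [|||i ig [q qps [qs Hi]]] := pure_decision Unp (D := fvalue f n)
      (p := laver_at_cond UU Unp ps_at) (s := s) _ _ (total n).
  - by move=> i q r; exact: fmem_le.
  - by move=> i q; exact: fmem_dense.
  - exact: ps_at.
  by exists i => //; exists q => //; apply: subset_trans qps _ => u [].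
pose v s n := xget 0 [set i | i < g n /\ val s n i].
have vg s n : v s n < g n.
  rewrite /v; case: xgetP => [i _ []//|_].
  by have [_ _ [i + _]] := total n p; apply: leq_ltn_trans.
have vE s n i : val s n i -> i < g n -> v s n = i.
  move=> si ig; rewrite /v; apply: xget_unique => // j [_ /val_inj]; exact.
have [s n ps s0s|T' [T'at T'p] T'v] := laver_prune_values ps0 vg.
  have [i ig [q qp [qs Hi]]] := ex_val s n ps s0s.
  rewrite (vE s n i) //; last by exists q.
  have [qss _ _ qsucc] := qs; apply: filterS (qsucc s qss (prefix_refl s)) => m qm.
  apply: vE => //; have qsm := laver_at_subtree UU qs qm (prefix_rcons s m).
  exists (laver_at_cond UU Unp qsm).
    by apply: subset_trans _ qp => u [].
  by split=> //; apply: fmem_le Hi => u [].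
pose S n := [set v t n | t in [set t | T' t /\ prefix s0 t]].
have SP n : S n `<=` `I_(g n) /\ S n #<= `I_n.+1.
  split; first by move=> _ [t _ <-]; exact: vg.
  have [l ln Tl] := T'v n; apply/card_le_seqP; exists l => // _ [t [Tt st] <-].
  exact: Tl.
exists (laver_at_cond UU Unp T'at); first exact: T'p.
exists (exist _ S SP); apply/pointwise_in_check_slalom => n q qT'.
have [r rq [i ig Hi]] := total n q; exists r => //; exists i => //.
have [t rt] := cond_laver_at Unp r.
have rT' := subset_trans rq qT'.
exists t; first split.
- by apply: rT'; exact: laver_at_node rt.
- exact: (laver_at_le UU Unp T'at rt rT').
by apply: vE => //; exists r => //; exact: subset_trans rT' T'p.
Qed.

End LaverToProperty.

(** * From the Laver property to Laver ultrafilters *)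

Section PropertyToLaver.
Variables (U : set_system nat) (UU : UltraFilter U).
Hypothesis Unp : nonprincipal U.
Local Notation LU := (laver_forcing UU).

Definition cone t : LU := laver_at_cond UU Unp (laver_at_cone UU t).

Lemma cone_eq (r : LU) t t' :
  r ≼ cone t -> r ≼ cone t' -> size t = size t' -> t = t'.
Proof.
move=> rt rt' tt'; have [s rs] := cond_laver_at Unp r.
have [u ru [_ tu]] := laver_at_long UU (size t) rs.
exact: compatible_eq (rt u ru) (rt' u ru) tt' tu.
Qed.

(** Below any condition, an initial segment of the generic real of any prescribed
    length can be decided. *)
Lemma cone_total (p : LU) n :
  exists2 r, r ≼ p & exists2 t, r ≼ cone t & size t = n.
Proof.
have [s ps] := cond_laver_at Unp p.
have [u pu [su nu]] := laver_at_long UU n ps.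
exists (laver_at_cond UU Unp (laver_at_subtree UU ps pu su)); first by move=> t [].
exists (take n u); last exact: size_takel.
by move=> t [_]; apply: compatible_prefixl; exact: prefix_take.
Qed.

Lemma laver_ultrafilter_of_property : laver_property LU -> laver_ultrafilter U.
Proof.
move=> LP; apply/laver_ultrafilterP => g w wg.
(* f(n) codes w(l(0), n), ..., w(l(n-1), n) for l the generic real: this is the
   value forced by a stem [t] of length n. *)
pose val t := code (fun=> g (size t)) (size t) (fun j => w (nth 0 t j) (size t)).
pose G n := \prod_(i < n) g n.
have valG t : val t < G (size t) by apply: code_lt => j _.
pose f := fun_name size val cone.
have fom : forces top (in_omega_omega f).
  apply: fun_name_in_omega_omega => [t t' r rt rt' tt'|n p].
    by rewrite (cone_eq rt rt' tt').
  exact: cone_total.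
have fG : forces top (pointwise_in f (check_fun LU G)).
  apply/pointwise_in_check_fun => n q _; have [r rq [t rt tn]] := cone_total q n.
  exists r => //; exists (val t); first by rewrite -tn.
  apply/fvalue_fun_name/dense_below_now => r' r'r.
  by exists t => //; exact: stronger_trans r'r rt.
have /dense_below_ex[p _ [[S SP] /pointwise_in_check_slalom pS]] := LP f G fom fG.
have [s ps] := cond_laver_at Unp p; have [pss pp pc psucc] := ps.
have valS t : sval p t -> prefix s t -> S (size t) (val t).
  move=> pt st; pose q := laver_at_cond UU Unp (laver_at_subtree UU ps pt st).
  have qp : q ≼ p by move=> u [].
  have [r rq [i Si /fvalue_fun_name/dense_below_ex]] := pS (size t) q qp.
  move=> [r' r'r [t' r't' [tt' E]]]; rewrite -E in Si.
  suff -> : t = t' by rewrite tt'.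
  by apply: (@cone_eq r') => // u /r'r/rq[].
have /choice_exists2[lim _ Ulim] n :
    exists2 i, i < g n & U (setT `&` [set m | w m n = i]).
  by apply: ultra_pigeonhole filterT _ => m _; exact: wg.
pose k := size s.
exists (succ_in (sval p) s `&` \bigcap_(n in `I_k.+1) [set m | w m n = lim n]).
  apply: filterI; first exact: psucc (prefix_refl s).
  elim: (k.+1) => [|j IH]; first by apply: filterS filterT => m _ n.
  apply: filterS (filterI IH (Ulim j)) => m [mIH [_ mj]] n /=.
  by rewrite ltnS leq_eqVlt => /predU1P[->//|]; exact: mIH.
move=> n; case: (leqP n k) => kn.
  by exists [:: lim n] => // m [_ /(_ n kn)]; rewrite inE => /eqP.
have [Sg /card_le_seqP[l ln Sl]] := SP n.
exists [seq decode (fun=> g n) n c k | c <- l]; first by rewrite size_map.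
move=> m [pm _]; apply/mapP.
have pm' : laver_at U (rcons s m) (subtree (sval p) (rcons s m)).
  exact: laver_at_subtree ps pm (prefix_rcons s m).
have [t [pt _] [smt nt]] := laver_at_long UU n pm'.
have smn : prefix (rcons s m) (take n t).
  apply: compatible_size; first exact: prefix_compatible smt (prefix_take t n).
  by rewrite size_rcons size_takel.
have stn := prefix_trans (prefix_rcons s m) smn.
have tn : size (take n t) = n by exact: size_takel.
have pt' : sval p (take n t) by apply: pp pt; exact: prefix_take.
exists (val (take n t)); first by apply: Sl; rewrite -{1}tn; exact: valS.
rewrite /val tn codeK //; congr w.
by move/prefixP: smn => [u ->]; rewrite nth_cat size_rcons ltnSn nth_rcons ltnn eqxx.
Qed.

End PropertyToLaver.

Theorem theorem2p8 (U : set_system nat) (UU : UltraFilter U)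
    (U_nonprincipal : nonprincipal U) :
  laver_property (laver_forcing UU) <-> laver_ultrafilter U.
Proof.
split; first exact: laver_ultrafilter_of_property.
exact: laver_property_of_ultrafilter.
Qed.
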